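(* Let $\mathbf C$ be a coreflective subcategory of $\mathbf{Top}$, and for each space $X$ let $C(X)$ be the $\mathbf C$-coreflection of $X$, realized on the underlying set of $X$. Let $\mathcal C$ be the operation given by $\mathcal C_X=\mathcal T_{C(X)}$, the class of all pairs (convergent net, limit) of the space $C(X)$. Then $\mathcal C$ is idempotent and consistent. Moreover, for every space $X$, $C(X)=\mathcal CX$; that is, the functor $\widetilde{\mathcal C}$ given by $\widetilde{\mathcal C}(X)=\mathcal CX$ on objects and $\widetilde{\mathcal C}(f)(x)=f(x)$ on morphisms is the coreflector for $\mathbf C$.
   Context: All spaces are $T_0$; $\mathbf{Top}$ is the category of $T_0$ spaces and continuous maps. A subcategory $\mathbf A$ of $\mathbf B$ is coreflective if for each $\mathbf B$-object $B$ there are an $\mathbf A$-object $A$ and a $\mathbf B$-morphism $c:A\to B$ (an $\mathbf A$-coreflection of $B$) such that for every $\mathbf B$-morphism $f:A'\to B$ from an $\mathbf A$-object $A'$ there is a unique $\mathbf A$-morphism $f':A'\to A$ with $f=c\circ f'$; the coreflector is the resulting functor $\mathbf B\to\mathbf A$, natural with respect to the coreflection maps. Subcategories of $\mathbf{Top}$ are full, closed under homeomorphism, and contain a non-empty space. For a coreflective subcategory $\mathbf C$ of $\mathbf{Top}$ the coreflection of $(X,\tau)$ can then be taken to be the identity map $(X,\eta_X)\to(X,\tau)$, where $\eta_X$ is the coarsest topology on $X$ that is finer than $\tau$ and satisfies $(X,\eta_X)\in\mathbf C$; write $C(X)=(X,\eta_X)$. A convergence class $\mathcal E$ on a set $X$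 is a class of pairs $(\xi,x)$ with $\xi$ a net in $X$ and $x\in X$. It determines a topology $\mathcal E(X)$ on $X$: $U\in\mathcal E(X)$ iff for all $(\xi,x)\in\mathcal E$, $x\in U$ implies that $\xi$ is eventually in $U$. For a space $X$, $\mathcal T_X$ denotes the class of all pairs $(\xi,x)$ such that the net $\xi$ converges to $x$ in $X$. A convergence class operation $\mathcal C$ assigns to every space $X$ a convergence class $\mathcal C_X\subseteq\mathcal T_X$ on $X$; write $\mathcal CX=(X,\mathcal C_X(X))$. $\mathcal C$ is idempotent if $\mathcal C_X\subseteq\mathcal C_{\mathcal CX}$ for every space $X$, and consistent if for every continuous $f:X\to Y$, $(\xi,x)\in\mathcal C_X$ implies $(f(\xi),f(x))\in\mathcal C_Y$. *)

(* Defs.v *)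
From HB Require Import structures.
From mathcomp Require Import all_boot all_order.
From mathcomp Require Import all_classical.
From mathcomp Require Import topology_structure separation_axioms.

Set Implicit Arguments.
Unset Strict Implicit.
Unset Printing Implicit Defensive.

Local Open Scope classical_set_scope.

(* Objects of Top.  Carriers may be empty: [topologicalType] is not pointed.  *)
Record space := Space {
  space_sort :> topologicalType;
  space_T0 : kolmogorov_space space_sort }.

(* A topology on the underlying set of X finer than that of X; such a
   topology is again T0.                                                      *)
Record refinement (X : topologicalType) := Refinement {
  ref_open : set (set X);
  ref_openI : setI_closed ref_open;
  ref_open_bigcup : forall F : set (set X),
    F `<=` ref_open -> ref_open (\bigcup_(A in F) A);
  ref_finer : open `<=` ref_open }.

HB.instance Definition _ (X : topologicalType) := gen_eqMixin (refinement X).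
HB.instance Definition _ (X : topologicalType) :=
  gen_choiceMixin (refinement X).

Definition refined (X : topologicalType) (r : refinement X) : Type := X.

Section RefinedTopology.
Variables (X : topologicalType) (r : refinement X).

HB.instance Definition _ := Choice.copy (refined r) X.

Fact refined_openT : ref_open r setT.
Proof. exact: ref_finer openT. Qed.

Fact refined_open_bigcup (I : Type) (f : I -> set X) :
  (forall i, ref_open r (f i)) -> ref_open r (\bigcup_i f i).
Proof.
move=> fr.
have -> : \bigcup_i f i = \bigcup_(A in range f) A by rewrite bigcup_image.
by apply: ref_open_bigcup => _ [i _ <-].
Qed.

HB.instance Definition _ := isOpenTopological.Build (refined r)
  refined_openT (@ref_openI X r) refined_open_bigcup.

End RefinedTopology.

Fact refined_openE (X : topologicalType) (r : refinement X) :
  (open : set (set (refined r))) = ref_open r.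
Proof. by []. Qed.

Fact refined_T0 (X : space) (r : refinement X) : kolmogorov_space (refined r).
Proof.
have sub (z : X) (A : set X) : nbhs z A -> nbhs (z : refined r) A.
  rewrite nbhsE => -[B [oB Bz] BA]; rewrite nbhsE; exists B => //.
  by split=> //; exact: (@ref_finer X r).
move=> x y xy; have [A [] [/set_mem nA /set_mem Ay]] := space_T0 xy; exists A.
  by left; split; apply: mem_set => //; exact: sub.
by right; split; apply: mem_set => //; exact: sub.
Qed.

Definition topology_of (X : topologicalType) : set (set X) := open.
Arguments topology_of : clear implicits.

Definition refined_space (X : space) (r : refinement X) : space :=
  Space (@refined_T0 X r).

Section TrivialRefinement.
Variable X : topologicalType.

Fact open_bigcup_set (F : set (set X)) :
  F `<=` open -> open (\bigcup_(A in F) A).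
Proof. by move=> oF; apply: bigcup_open => A /oF. Qed.

Definition trivial_refinement : refinement X :=
  Refinement (@openI X) open_bigcup_set (fun _ oU => oU).

End TrivialRefinement.

Definition homeomorphic (X Y : topologicalType) :=
  exists (f : X -> Y) (g : Y -> X),
    [/\ continuous f, continuous g, cancel f g & cancel g f].

(* A full subcategory of Top is given by its class of objects, its morphisms
   being all continuous maps between them.                                    *)
Record subcategory := Subcategory {
  sub_obj :> space -> Prop;
  sub_homeo : forall X Y : space, sub_obj X -> homeomorphic X Y -> sub_obj Y;
  sub_nonempty : exists2 X : space, sub_obj X & inhabited X }.

Definition is_coreflection (C : subcategory) (A B : space) (c : A -> B) :=
  [/\ C A, continuous c &
      forall (A' : space) (f : A' -> B), C A' -> continuous f ->
        exists! f' : A' -> A, continuous f' /\ f = c \o f'].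

Definition coreflective (C : subcategory) :=
  forall B : space, exists (A : space) (c : A -> B), is_coreflection C c.

(* [F1] acts on underlying functions; only its values on continuous maps
   matter.                                                                    *)
Definition is_functor (F0 : space -> space)
    (F1 : forall X Y : space, (X -> Y) -> F0 X -> F0 Y) :=
  [/\ forall (X Y : space) (f : X -> Y), continuous f -> continuous (F1 X Y f),
      forall X : space, F1 X X id = id &
      forall (X Y Z : space) (f : X -> Y) (g : Y -> Z),
        continuous f -> continuous g ->
        F1 X Z (g \o f) = F1 Y Z g \o F1 X Y f].

Definition is_coreflector (C : subcategory) (F0 : space -> space)
    (F1 : forall X Y : space, (X -> Y) -> F0 X -> F0 Y)
    (c : forall X : space, F0 X -> X) :=
  [/\ is_functor F1,
      forall X : space, is_coreflection C (c X) &
      forall (X Y : space) (f : X -> Y), continuous f ->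
        c Y \o F1 X Y f = f \o c X].

Definition coarsest_refinement_in (C : subcategory) (X : space)
    (r : refinement X) :=
  C (refined_space r) /\
  forall r' : refinement X,
    C (refined_space r') -> ref_open r `<=` ref_open r'.

(* C(X) = (X, eta_X), with eta_X the coarsest topology finer than that of X
   for which (X, eta_X) is in C; it exists when C is coreflective, and the
   topology of X is only the default value of the choice operator.            *)
Definition coreflection (C : subcategory) (X : space) : space :=
  refined_space
    (xget (trivial_refinement X) [set r | coarsest_refinement_in C r]).

Record directed_set := DirectedSet {
  dir_sort :> Type;
  dir_le : dir_sort -> dir_sort -> Prop;
  dir_refl : forall i, dir_le i i;
  dir_trans : forall i j k, dir_le i j -> dir_le j k -> dir_le i k;
  dir_inhabited : inhabited dir_sort;
  dir_directed : forall i j, exists k, dir_le i k /\ dir_le j k }.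

Record net (T : Type) := Net {
  net_dom : directed_set;
  net_fun :> net_dom -> T }.

Definition net_map (T U : Type) (f : T -> U) (xi : net T) : net U :=
  Net (f \o xi).

Definition eventually_in (T : Type) (xi : net T) : set_system T :=
  [set A | exists i, forall j, dir_le i j -> A (xi j)].

Definition conv_class (T : Type) := net T -> T -> Prop.

Definition conv_open (T : Type) (E : conv_class T) : set (set T) :=
  [set U | forall xi x, E xi x -> U x -> eventually_in xi U].

Definition net_conv (X : topologicalType) : conv_class X :=
  fun xi x => eventually_in xi --> x.

Record conv_op := ConvOp {
  op_class :> forall X : space, conv_class X;
  op_sub : forall (X : space) (xi : net X) (x : X),
    op_class xi x -> net_conv xi x }.

Section ConvOpSpace.
Variables (K : conv_op) (X : space).

Fact conv_openI : setI_closed (conv_open (@K X)).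
Proof.
move=> U V oU oV xi x Kx [Ux Vx].
have [i iU] := oU _ _ Kx Ux; have [j jV] := oV _ _ Kx Vx.
have [k [ik jk]] := dir_directed i j; exists k => l kl; split.
  by apply: iU; exact: dir_trans kl.
by apply: jV; exact: dir_trans kl.
Qed.

Fact conv_open_bigcup (F : set (set X)) :
  F `<=` conv_open (@K X) -> conv_open (@K X) (\bigcup_(A in F) A).
Proof.
move=> oF xi x Kx [A FA Ax]; have [i iA] := oF _ FA _ _ Kx Ax.
by exists i => j ij; exists A => //; exact: iA.
Qed.

Fact conv_open_finer : open `<=` conv_open (@K X).
Proof.
move=> U oU xi x Kx Ux.
by have /(_ U) := op_sub Kx; apply; exact: open_nbhs_nbhs.
Qed.

Definition conv_space : space :=
  refined_space (Refinement conv_openI conv_open_bigcup conv_open_finer).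

End ConvOpSpace.

Definition idempotent_conv (K : conv_op) :=
  forall (X : space) (xi : net X) (x : X), K X xi x -> K (conv_space K X) xi x.

Definition consistent_conv (K : conv_op) :=
  forall (X Y : space) (f : X -> Y), continuous f ->
  forall (xi : net X) (x : X), K X xi x -> K Y (net_map f xi) (f x).

(* The action of the functor induced by K on maps: f seen as a map between
   the retopologized spaces.                                                  *)
Definition conv_map (K : conv_op) (X Y : space) (f : X -> Y) :
  conv_space K X -> conv_space K Y := f.

Definition conv_counit (K : conv_op) (X : space) : conv_space K X -> X := id.

Section CoreflectionOp.
Variable C : subcategory.

Definition coreflection_class (X : space) : conv_class X :=
  @net_conv (coreflection C X).

Fact coreflection_class_sub (X : space) (xi : net X) (x : X) :
  coreflection_class xi x -> net_conv xi x.
Proof.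
move=> cv A; rewrite nbhsE => -[B [oB Bx] BA].
have [i iB] : eventually_in xi B.
  apply: cv; apply: (@open_nbhs_nbhs (coreflection C X)); split=> //.
  exact: (@ref_finer X _ _ oB).
by exists i => j ij; apply: BA; exact: iB.
Qed.

Definition coreflection_op : conv_op := ConvOp coreflection_class_sub.

End CoreflectionOp.

(* Main.v *)
Require Import Defs.
From mathcomp Require Import all_boot all_order.
From mathcomp Require Import all_classical.
From mathcomp Require Import topology_structure separation_axioms.

(** There are two independent ingredients.

    On the categorical side, every coreflection map c : A -> B of C is a
    bijection: if N is a non-empty space of C, then a point of A or of B is a
    constant map from N, and the universal property matches the constant maps
    into A with those into B.  Carrying the topology of A over to B along c
    therefore gives a refinement of B that lies in C, and factoring the identity
    map of any competing refinement through c shows that it is the coarsest such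
    refinement ([coarsest_refinement_exists]).  So C(X) really is the coarsest
    refinement of X in C, the identity C(X) -> X has the universal property
    ([continuous_to_coarsest]), and C(X) = X when X is in C.

    On the topological side, a topology is determined by its convergent nets
    ([conv_open_net_conv]), so that the sets which are open for the class of
    convergent nets of C(X) are exactly the open sets of C(X).  The space built
    from the convergence class is thus C(X) itself
    ([conv_refinement_coreflection_op]).

    Idempotence then says that C(C(X)) = C(X), consistency is the continuity of
    f : C(X) -> C(Y), and the functor is the coreflector by the universal
    property of C(X) -> X. *)

Set Implicit Arguments.
Unset Strict Implicit.
Unset Printing Implicit Defensive.

Local Open Scope classical_set_scope.

(** * Refinements *)

Lemma refinement_ext (X : topologicalType) (r s : refinement X) :
  ref_open r = ref_open s -> r = s.
Proof.
case: r s => [P PI PU PX] [Q QI QU QX] /= PQ; move: QI QU QX.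
by rewrite -PQ => QI QU QX; congr Refinement; exact: Prop_irrelevance.
Qed.

Lemma continuous_to_refined (Z X : topologicalType) (r : refinement X)
    (f : Z -> refined r) :
  continuous f <-> forall U, ref_open r U -> open (f @^-1` U).
Proof. exact: continuousP. Qed.

Lemma refined_id_continuous (X : topologicalType) (r : refinement X) :
  continuous (id : refined r -> X).
Proof. by apply/continuousP => U oU; exact: (@ref_finer X r). Qed.

Lemma sub_trivial_refinement (C : subcategory) (X : space) :
  C X -> C (refined_space (trivial_refinement X)).
Proof.
move=> CX; apply: (sub_homeo CX); exists id, id; split => //.
  exact/continuous_to_refined.
exact: refined_id_continuous.
Qed.

(** * Coreflections are coarsest refinements *)

(** Constant maps from a non-empty space of C play the role of points, so the
    existence and uniqueness of factorizations through c give surjectivity and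
    injectivity of c. *)
Lemma coreflection_bijective (C : subcategory) (A B : space) (c : A -> B) :
  is_coreflection C c -> exists2 g : B -> A, cancel c g & cancel g c.
Proof.
move=> [CA cc univ]; have [N CN [n]] := sub_nonempty C.
have c_inj : injective c.
  move=> a b cab.
  have [f [_ uniq]] := univ N (cst (c a)) CN (@cst_continuous _ _ _).
  have fa : f = cst a by apply: uniq; split=> //; exact: cst_continuous.
  have fb : f = cst b.
    by apply: uniq; split; [exact: cst_continuous|rewrite cab].
  by have := congr1 (@^~ n) fa; rewrite fb.
have /choice [g gK] : forall b, exists a, c a = b.
  move=> b.
  have [f [[_ cf] _]] := univ N (cst b) CN (@cst_continuous _ _ _).
  by exists (f n); have := congr1 (@^~ n) cf.
by exists g => // a; apply: c_inj; exact: gK.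
Qed.

Section FinalRefinement.
Variables (A B : topologicalType) (c : A -> B).
Hypothesis cc : continuous c.

Fact final_openI : setI_closed [set U : set B | open (c @^-1` U)].
Proof. by move=> U V oU oV; exact: openI. Qed.

Fact final_open_bigcup (F : set (set B)) :
  F `<=` [set U | open (c @^-1` U)] ->
  open (c @^-1` (\bigcup_(U in F) U)).
Proof. by move=> oF; rewrite preimage_bigcup; apply: bigcup_open => U /oF. Qed.

Fact final_finer : open `<=` [set U : set B | open (c @^-1` U)].
Proof. by move=> U oU; move/continuousP: cc; apply. Qed.

(** For bijective c, this is the topology of A carried over to B. *)
Definition final_refinement : refinement B :=
  Refinement final_openI final_open_bigcup final_finer.

End FinalRefinement.

Lemma final_refinement_coarsest (C : subcategory) (A B : space) (c : A -> B)
    (cc : continuous c) :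
  is_coreflection C c -> coarsest_refinement_in C (final_refinement cc).
Proof.
move=> corc; have [g cK gK] := coreflection_bijective corc.
case: corc => CA _ univ; split.
  apply: (sub_homeo CA); exists c, g; split => //.
    exact/continuous_to_refined.
  apply/continuousP => U oU; rewrite refined_openE /=.
  by rewrite -comp_preimage (_ : g \o c = id) //; apply/funext.
move=> r' Cr' U oU.
(* The identity of a refinement in C factors as c \o f; pull back along f. *)
have [f [[fc idE] _]] := univ _ _ Cr' (@refined_id_continuous B r').
rewrite -[U]/(id @^-1` U) [X in X @^-1` _]idE comp_preimage.
by move/continuousP: fc; apply.
Qed.

Lemma coarsest_refinement_exists (C : subcategory) (X : space) :
  coreflective C -> exists r : refinement X, coarsest_refinement_in C r.
Proof.
move=> hC; have [A [c corc]] := hC X; have [_ cc _] := corc.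
by exists (final_refinement cc); exact: final_refinement_coarsest.
Qed.

(** A coarsest refinement has at most the open sets of the one carried over from
    a coreflection A, and f factors continuously through A. *)
Lemma continuous_to_coarsest (C : subcategory) (X : space) (r : refinement X) :
  coreflective C -> coarsest_refinement_in C r ->
  forall (Z : space) (f : Z -> X), C Z -> continuous f ->
    continuous (f : Z -> refined r).
Proof.
move=> hC [_ rmin] Z f CZ fc; have [A [c corc]] := hC X.
have [_ cc univ] := corc.
have [Cfin _] := final_refinement_coarsest cc corc.
have [f' [[f'c fE] _]] := univ Z f CZ fc.
apply/continuous_to_refined => U /(rmin _ Cfin) oU.
by rewrite fE comp_preimage; move/continuousP: f'c; apply.
Qed.

(** * Nets determine the topology *)

(** The canonical net at x runs through the pointed neighbourhoods of x, ordered
    by reverse inclusion of the neighbourhoods; indexing by pairs makes all the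
    points of a neighbourhood values of the net beyond it. *)
Section NeighbourhoodNet.
Variables (X : topologicalType) (x : X).

Let index := {p : set X * X | nbhs x p.1 /\ p.1 p.2}.
Let index_le (p q : index) := (sval q).1 `<=` (sval p).1.

Let mk_index (A : set X) (y : X) (xA : nbhs x A) (Ay : A y) : index :=
  exist _ (A, y) (conj xA Ay).

Fact index_le_refl p : index_le p p. Proof. by []. Qed.

Fact index_le_trans p q s : index_le p q -> index_le q s -> index_le p s.
Proof. by move=> pq qs; exact: subset_trans qs pq. Qed.

Fact index_inhabited : inhabited index.
Proof. exact: inhabits (@mk_index setT x filterT I). Qed.

Fact index_directed p q : exists s, index_le p s /\ index_le q s.
Proof.
have xI : nbhs x ((sval p).1 `&` (sval q).1).
  exact: filterI (svalP p).1 (svalP q).1.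
by exists (mk_index xI (nbhs_singleton xI)); split=> y [].
Qed.

Definition nbhs_net : net X :=
  Net (fun p : DirectedSet index_le_refl index_le_trans index_inhabited
                 index_directed => (sval p).2).

Lemma nbhs_netE : eventually_in nbhs_net = nbhs x.
Proof.
apply/seteqP; split=> A.
  move=> [p pA]; apply: filterS (svalP p).1 => y py.
  exact: (pA (mk_index (svalP p).1 py)).
move=> xA; exists (mk_index xA (nbhs_singleton xA)) => p; apply.
exact: (svalP p).2.
Qed.

End NeighbourhoodNet.

Lemma conv_open_net_conv (X : topologicalType) :
  conv_open (@net_conv X) = open.
Proof.
apply/seteqP; split=> U.
  move=> oU; rewrite openE => x Ux; rewrite /interior -nbhs_netE.
  by apply: (oU _ x) => //; rewrite /net_conv nbhs_netE.
by move=> oU xi x xix Ux; apply: xix; exact: open_nbhs_nbhs.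
Qed.

Lemma net_conv_continuous (X Y : topologicalType) (f : X -> Y) (xi : net X)
    (x : X) :
  continuous f -> net_conv xi x -> net_conv (net_map f xi) (f x).
Proof. by move=> fc xix A /(fc x)/xix. Qed.

(** * The coreflector *)

(** The spaces C(X) and [conv_space K X] are named here by their refinements:
    along an equation of refinements of X, unlike one of spaces, the underlying
    set stays X and statements about maps can be transported. *)
Definition coreflection_refinement (C : subcategory) (X : space) :
    refinement X :=
  xget (trivial_refinement X) [set r | coarsest_refinement_in C r].

Definition conv_refinement (K : conv_op) (X : space) : refinement X :=
  Refinement (@conv_openI K X) (@conv_open_bigcup K X) (@conv_open_finer K X).

Lemma conv_refinement_coreflection_op (C : subcategory) (X : space) :
  conv_refinement (coreflection_op C) X = coreflection_refinement C X.
Proof.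
apply: refinement_ext; exact: (conv_open_net_conv (coreflection C X)).
Qed.

Section Coreflector.
Variable C : subcategory.
Hypothesis hC : coreflective C.

Lemma coreflection_coarsest (X : space) :
  coarsest_refinement_in C (coreflection_refinement C X).
Proof.
have [r rP] := coarsest_refinement_exists X hC.
exact: (xgetPex (trivial_refinement X) (ex_intro _ r rP)).
Qed.

Lemma coreflection_counit (X : space) :
  is_coreflection C (id : coreflection C X -> X).
Proof.
split; first exact: (coreflection_coarsest X).1.
  exact: refined_id_continuous.
move=> Z f CZ fc; exists f; split; last by move=> f' [].
by split=> //; exact: continuous_to_coarsest (coreflection_coarsest X) _ _ CZ fc.
Qed.

Lemma coreflection_continuous (X Y : space) (f : X -> Y) :
  continuous f -> continuous (f : coreflection C X -> coreflection C Y).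
Proof.
move=> fc; have [CX idc _] := coreflection_counit X.
apply: (continuous_to_coarsest hC (coreflection_coarsest Y)) => // x.
exact: continuous_comp (idc x) (fc x).
Qed.

(** When X is in C, its own topology competes with the coarsest refinement. *)
Lemma coreflection_id_continuous (X : space) :
  C X -> continuous (id : X -> coreflection C X).
Proof.
move=> CX; apply/continuous_to_refined => U.
exact: (coreflection_coarsest X).2 (sub_trivial_refinement CX) U.
Qed.

End Coreflector.

Theorem proposition31 (C : subcategory) (hC : coreflective C) :
  [/\ idempotent_conv (coreflection_op C),
      consistent_conv (coreflection_op C),
      forall X : space,
        topology_of (coreflection C X)
        = topology_of (conv_space (coreflection_op C) X) &
      is_coreflector C (@conv_map (coreflection_op C))
        (@conv_counit (coreflection_op C))].
Proof.
have convE X := conv_refinement_coreflection_op C X.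
split.
- move=> X xi x.
  change (net_conv (X := coreflection C X) xi x ->
    net_conv (X := coreflection C
      (refined_space (conv_refinement (coreflection_op C) X))) xi x).
  rewrite convE => xix; have [CX _ _] := coreflection_counit hC X.
  by move=> A /(coreflection_id_continuous hC CX)/xix.
- move=> X Y f fc xi x.
  exact: net_conv_continuous (coreflection_continuous hC fc).
- move=> X; change (ref_open (coreflection_refinement C X) =
    ref_open (conv_refinement (coreflection_op C) X)).
  by rewrite convE.
- split=> //; last first.
    move=> X; change (is_coreflection C (id : refined_space
      (conv_refinement (coreflection_op C) X) -> X)).
    by rewrite convE; exact: coreflection_counit.
  split=> // X Y f fc.
  change (continuous (f : refined (conv_refinement (coreflection_op C) X) ->
    refined (conv_refinement (coreflection_op C) Y))).
  by rewrite !convE; exact: coreflection_continuous.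
Qed.
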